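(* Let $x=\{x_1,x_2,\ldots\}\in\mathbb R^\infty$, let $\mathbf G_1$ be a set of rows and columns (of infinite matrices), and let $m$ be a positive integer or $m=\infty$. Assume that at least one of the following conditions is fulfilled: (1) $m<\infty$; (2) $m=\infty$ and either $\mathbf G_1$ consists only of rows (i.e. $\mathbf G_1\subseteq\mathbf G_r$) or $\mathbf G_1$ contains all columns; (3) $m=\infty$ and $x_j\ne x_k$ whenever $j\ne k$. Then $\operatorname{ex}S_{x,(m)}^{\mathbf G_1}\subset P_{x,(m)}^{\mathbf G_1}$. If (3) holds true and $x$ does not contain zero entries, then $wx\notin\operatorname{ex}S_x^{\mathbf G_1}$ whenever $w\in(\mathcal S^{\mathbf G_1}\setminus\mathcal P^{\mathbf G_1})\cap\mathcal V_x$.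
   Context: $\mathbb R^\infty$ is the space of all real sequences. All matrices are infinite real matrices $w=\{w_{ij}\}_{i,j=1,2,\ldots}$, $i$ numbering rows and $j$ columns. $\mathbf G_r$ is the set of all rows. For a set $\mathbf G_1$ of rows and columns (i.e. of row positions and column positions), $\mathcal S^{\mathbf G_1}$ is the set of matrices with non-negative entries whose row sums and column sums are all at most $1$ and are equal to $1$ for every row and column belonging to $\mathbf G_1$; $\mathcal P^{\mathbf G_1}$ is the set of matrices in $\mathcal S^{\mathbf G_1}$ all of whose entries are $0$ or $1$. A matrix $w$ acts by $(wx)_i=\sum_jw_{ij}x_j$. $\mathcal V_x$ is the space of matrices $w$ such that $\sum_j|w_{ij}x_j|<\infty$ for every $i$. $S_x^{\mathbf G_1}:=\{wx:w\in\mathcal S^{\mathbf G_1}\cap\mathcal V_x\}$ and $P_x^{\mathbf G_1}:=\{wx:w\in\mathcal P^{\mathbf G_1}\}$. For $y\in\mathbb R^\infty$ put $y^{(m)}:=\{y_1,\ldots,y_m,0,0,\ldots\}$ (identified with a vector in $\mathbb R^m$) if $m<\infty$, and $y^{(\infty)}:=y$. $S_{x,(m)}^{\mathbf G_1}:=\{y^{(m)}:y\in S_x^{\mathbf G_1}\}$ and $P_{x,(m)}^{\mathbf G_1}:=\{y^{(m)}:y\in P_x^{\mathbf G_1}\}$. $\operatorname{ex}\Omega$ is the set of extreme points of $\Omega$, i.e. of elements of $\Omega$ which are not convex linear combinations of two other elements of $\Omega$. *)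

(* Defs.v *)
From HB Require Import structures.
From mathcomp Require Import all_boot all_order all_algebra.
From mathcomp Require Import all_classical all_reals all_analysis.

Set Implicit Arguments.
Unset Strict Implicit.
Unset Printing Implicit Defensive.

Import Order.TTheory GRing.Theory Num.Theory.
Import numFieldNormedType.Exports.

Local Open Scope classical_set_scope.
Local Open Scope ring_scope.

Definition extreme_points (R : realType) (E : lmodType R) (A : set E) : set E :=
  [set y | A y /\
    ~ exists a b : E, exists t : R,
        [/\ A a /\ A b, a <> y /\ b <> y, 0 <= t <= 1 &
            y = t *: a + (1 - t) *: b]].

(* Rows and columns are numbered from 0. *)
Definition inf_matrix (R : realType) : Type := nat -> nat -> R.

(* A line (row or column position): inl i is row i, inr j is column j. *)
Definition line : Type := (nat + nat)%type.

Definition all_rows : set line := range inl.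
Definition all_cols : set line := range inr.

Definition line_sum (R : realType) (w : inf_matrix R) (g : line) : \bar R :=
  match g with
  | inl i => (\sum_(0 <= j <oo) (w i j)%:E)%E
  | inr j => (\sum_(0 <= i <oo) (w i j)%:E)%E
  end.

Definition Smat (R : realType) (G1 : set line) : set (inf_matrix R) :=
  [set w | [/\ forall i j, 0 <= w i j,
               forall g, (line_sum w g <= 1)%E &
               forall g, G1 g -> line_sum w g = 1%E]].

Definition Pmat (R : realType) (G1 : set line) : set (inf_matrix R) :=
  [set w | Smat G1 w /\ forall i j, w i j = 0 \/ w i j = 1].

Definition Vmat (R : realType) (x : R^nat) : set (inf_matrix R) :=
  [set w | forall i, (\sum_(0 <= j <oo) `|w i j * x j|%:E < +oo)%E].

(* The series is only meaningful when it converges, in particular for w in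
   Vmat x; every matrix in Pmat G1 has at most one nonzero entry in each row,
   hence belongs to Vmat x. *)
Definition mx_act (R : realType) (w : inf_matrix R) (x : R^nat) :
    R^nat :=
  fun i => limn (series (fun j => w i j * x j)).

Definition Sset (R : realType) (G1 : set line) (x : R^nat) :
    set (R^nat) :=
  [set mx_act w x | w in Smat G1 `&` Vmat x].

Definition Pset (R : realType) (G1 : set line) (x : R^nat) :
    set (R^nat) :=
  [set mx_act w x | w in Pmat G1].

(* None stands for m = oo. *)
Definition trunc (R : realType) (m : option nat) (y : R^nat) :
    R^nat :=
  match m with
  | Some n => fun i => if (i < n)%N then y i else 0
  | None => y
  end.

Definition Sset_trunc (R : realType) (m : option nat) (G1 : set line)
    (x : R^nat) : set (R^nat) :=
  [set trunc m y | y in Sset G1 x].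

Definition Pset_trunc (R : realType) (m : option nat) (G1 : set line)
    (x : R^nat) : set (R^nat) :=
  [set trunc m y | y in Pset G1 x].

(* Main.v *)
Require Import Defs.
From HB Require Import structures.
From mathcomp Require Import all_boot all_order all_algebra.
From mathcomp Require Import all_classical all_reals all_analysis.
From mathcomp Require Import zify ring lra.

Set Implicit Arguments.
Unset Strict Implicit.
Unset Printing Implicit Defensive.

Import Order.TTheory GRing.Theory Num.Theory.
Import numFieldNormedType.Exports.

Local Open Scope classical_set_scope.
Local Open Scope ring_scope.

(** Let [y] be an extreme point of the (truncated) orbit and let [w] be any
matrix of the class with image [y].  The matrices of the class that occur in a
decomposition of [w] as a proper convex combination, the face of [w], also have
image [y].  This freedom is used to turn all entries into 0 or 1.

The face is explored one entry at a time.  If [a = w i j] lies strictly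
between 0 and 1, then [w = a w1 + (1 - a) w2] with [w1], [w2] in the class and
[w1 i j = 1] (lemma [Smat_split]).  Think of [w] as the expectation of a
random matching of rows with columns, which leaves a line unmatched with
probability one minus its sum; then [w1] is the expectation given that [i] is
matched with [j], and [w2] the one given that it is not.  Replacing [w] by
[w1] keeps the image [y] (when [y] is extreme), keeps every entry that is
already 0 or 1, and makes row [i] and column [j] entirely 0-1.  Doing this
along an enumeration of all rows and columns, each line is frozen after
finitely many stages (lemma [extreme_settle_line]); the frozen lines fit
together into a 0-1 matrix [p] each line of which is a line of some matrix of
the face, so [p] has the right line sums and the image [y]
(lemma [extreme_in_Pset]).

The splitting itself is first obtained for finite blocks.  A block of size [n]
is bordered by a row and a column that absorb what its line sums lack of 1,
so that all margins become integers.  The existence of a splitting is a convex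
property of the bordered matrix and is obvious for integral matrices; it
therefore holds in general by the transportation form of Birkhoff's theorem
(lemma [convex_integral_principle]): a matrix with integral margins and some
fractional entry can be moved in two opposite directions along a circulation
supported by its fractional entries until one of these entries becomes
integral.  The bounds on the blocks do not depend on [n], and a limit along an
ultrafilter gives the infinite splitting (lemma [substochastic_split]).

For the second assertion, the same splitting shows that if [w x] is extreme
then [(w x) i = x j] for every [j] with [w i j > 0]
(lemma [extreme_value_on_support]).  When the entries of [x] are distinct, row
[i] has only one nonzero entry [w i j], whence [x j = w i j * x j], and
[w i j = 1] because [x j] is not zero. *)

(** * Circulations on finite bipartite graphs *)

Lemma card_imset_paired (T U : finType) (f : T -> U) (F : {set T}) :
  (forall e, e \in F -> exists2 e', e' \in F & e' != e /\ f e' = f e) ->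
  (2 * #|f @: F| <= #|F|)%N.
Proof.
move=> paired; rewrite -[leqRHS]sum1_card (partition_big_imset f) /= mulnC.
rewrite -sum_nat_const.
apply: leq_sum => _ /imsetP[e eF ->].
have [e' e'F [ne' fe']] := paired e eF.
rewrite sum1dep_card; apply/card_gt1P; exists e, e'.
by split; rewrite ?inE ?eF ?e'F ?fe' ?eqxx // eq_sym.
Qed.

Lemma left_kernel_nonzero (K : fieldType) (m n : nat) (M : 'M[K]_(m, n)) :
  (n < m)%N -> exists2 u : 'rV[K]_m, u != 0 & u *m M = 0.
Proof.
move=> lt_nm; have : kermx M != 0.
  by rewrite kermx_eq0 /row_free ltn_eqF // (leq_ltn_trans (rank_leq_col M)).
by case/rowV0Pn => u /sub_kermxP uM0 u_neq0; exists u.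
Qed.

(** A finite bipartite graph without leaves carries a nonzero circulation.  The
number of its edges is at least twice the number of rows met, and twice the
number of columns met, hence at least the number of lines met; on the other
hand one of the balance equations follows from the others, because the total
over the rows is the total over the columns.  So there are more unknowns than
equations. *)
Lemma circulation_exists (K : fieldType) (p q : nat)
    (F : {set 'I_p * 'I_q}) :
  F != finset.set0 ->
  (forall e, e \in F -> exists2 e', e' \in F & e' != e /\ e'.1 = e.1) ->
  (forall e, e \in F -> exists2 e', e' \in F & e' != e /\ e'.2 = e.2) ->
  exists d : 'M[K]_(p, q),
    [/\ d != 0, forall i j, (i, j) \notin F -> d i j = 0,
        forall i, \sum_j d i j = 0 & forall j, \sum_i d i j = 0].
Proof.
move=> /set0Pn[e0 e0F] pair1 pair2.
pose Rs := fst @: F; pose Cs := snd @: F.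
have le_R := card_imset_paired pair1; have le_C := card_imset_paired pair2.
have j0C : e0.2 \in Cs by apply/imsetP; exists e0.
have cardC : (#|Cs :\ e0.2| < #|Cs|)%N by rewrite (cardsD1 e0.2 Cs) j0C.
have ltF : (#|Rs| + #|Cs :\ e0.2| < #|F|)%N.
  by rewrite -/Rs -/Cs in le_R le_C *; lia.
pose E (k : 'I_#|F|) := enum_val k.
pose M : 'M[K]_(#|F|, #|Rs| + #|Cs :\ e0.2|) :=
  row_mx (\matrix_(k, i) ((E k).1 == enum_val i)%:R)
         (\matrix_(k, j) ((E k).2 == enum_val j)%:R).
have [u u_neq0 uM0] := left_kernel_nonzero M ltF.
pose d : 'M[K]_(p, q) := \matrix_(i, j) (\sum_k u 0 k * (E k == (i, j))%:R).
have rowE i : \sum_j d i j = \sum_k u 0 k * ((E k).1 == i)%:R.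
  under eq_bigr do rewrite mxE.
  rewrite exchange_big /=; apply: eq_bigr => k _; rewrite -mulr_sumr.
  congr (_ * _).
  rewrite (bigD1 (E k).2) //= big1 ?addr0.
    by case: (E k) => a b; rewrite xpair_eqE eqxx andbT.
  move=> j; case: (E k) => a b /=; rewrite xpair_eqE eq_sym => /negPf->.
  by rewrite andbF.
have colE j : \sum_i d i j = \sum_k u 0 k * ((E k).2 == j)%:R.
  under eq_bigr do rewrite mxE.
  rewrite exchange_big /=; apply: eq_bigr => k _; rewrite -mulr_sumr.
  congr (_ * _).
  rewrite (bigD1 (E k).1) //= big1 ?addr0.
    by case: (E k) => a b; rewrite xpair_eqE eqxx.
  by move=> i; case: (E k) => a b /=; rewrite xpair_eqE eq_sym => /negPf->.
have row0 i : \sum_j d i j = 0.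
  rewrite rowE; have [iR|iR] := boolP (i \in Rs).
    have /matrixP/(_ 0 (lshift _ (enum_rank_in iR i))) := uM0.
    rewrite mul_mx_row row_mxEl !mxE => {2}<-; apply: eq_bigr => k _.
    by rewrite mxE enum_rankK_in.
  rewrite big1 // => k _; case: eqP => [Ei|_]; last by rewrite mulr0.
  by case/negP: iR; apply/imsetP; exists (E k) => //; exact: enum_valP.
have col0' j : j != e0.2 -> \sum_i d i j = 0.
  move=> jj0; rewrite colE; have [jC|jC] := boolP (j \in Cs :\ e0.2).
    have /matrixP/(_ 0 (rshift _ (enum_rank_in jC j))) := uM0.
    rewrite mul_mx_row row_mxEr !mxE => {2}<-; apply: eq_bigr => k _.
    by rewrite mxE enum_rankK_in.
  rewrite big1 // => k _; case: eqP => [Ej|_]; last by rewrite mulr0.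
  case/negP: jC; rewrite in_setD1 jj0 /=; apply/imsetP.
  by exists (E k) => //; exact: enum_valP.
exists d; split => //.
- have /rV0Pn[k uk] := u_neq0.
  apply/eqP => d0; have /matrixP/(_ (E k).1 (E k).2) := d0.
  rewrite !mxE (bigD1 k) //= -surjective_pairing eqxx mulr1 big1 ?addr0.
    by apply/eqP.
  by move=> k' k'k; rewrite (inj_eq enum_val_inj) (negPf k'k) mulr0.
- move=> i j ijF; rewrite mxE big1 // => k _.
  case: eqP => [Ek|_]; last by rewrite mulr0.
  by rewrite -Ek enum_valP in ijF.
(* the equation of column [e0.2], which was left out of the system *)
move=> j; have [->|] := eqVneq j e0.2; last exact: col0'.
have : \sum_j \sum_i d i j = 0.
  by rewrite exchange_big /= big1 // => i _; exact: row0.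
rewrite (bigD1 e0.2) //= [X in _ + X]big1 ?addr0 // => j' ?; exact: col0'.
Qed.

(** * Rounding matrices with integral margins *)

Definition fractional (R : realType) (p q : nat) (Z : 'M[R]_(p, q)) :
    {set 'I_p * 'I_q} :=
  finset (fun e => Z e.1 e.2 \isn't a Num.int).

(** Moving along [d] until the first fractional entry reaches the next integer
in its direction of motion.  No other entry crosses an integer before, so
signs are kept. *)
Lemma push_to_integer (R : realType) (p q : nat) (Z d : 'M[R]_(p, q)) :
  d != 0 -> (forall i j, 0 <= Z i j) ->
  (forall i j, (i, j) \notin fractional Z -> d i j = 0) ->
  exists2 t : R, 0 < t &
    (forall i j, 0 <= (Z + t *: d) i j) /\
    (#|fractional (Z + t *: d)%R| < #|fractional Z|)%N.
Proof.
move=> d_neq0 Z_ge0 dF.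
have [e0 de0] : exists e, d e.1 e.2 != 0.
  apply: contrapT => all0; case/eqP: d_neq0; apply/matrixP => i j; rewrite mxE.
  by apply/eqP/negP => /negP dij; apply: all0; exists (i, j).
pose target e : R := if 0 < d e.1 e.2 then (Num.ceil (Z e.1 e.2))%:~R
                     else (Num.floor (Z e.1 e.2))%:~R.
pose tau e := (target e - Z e.1 e.2) / d e.1 e.2.
have fracP e : d e.1 e.2 != 0 -> Z e.1 e.2 \isn't a Num.int.
  move=> de; apply: contra de => Zint; apply/eqP/dF.
  by rewrite inE negbK.
have tau_gt0 e : d e.1 e.2 != 0 -> 0 < tau e.
  move=> de; have Zf := fracP _ de; rewrite /tau /target.
  case: (ltrP 0 (d e.1 e.2)) => [d_gt0|d_le0].
    rewrite divr_gt0 // subr_gt0 lt_neqAle ceil_ge andbT eq_sym.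
    by rewrite -intrEceil.
  rewrite nmulr_lgt0 ?invr_lt0 ?lt_neqAle ?de // subr_le0 floor_le andbT.
  by rewrite subr_eq0 -intrEfloor.
(* [tau e] is the time at which the entry [e] reaches its target *)
case: (@arg_minP _ _ _ e0 (fun e => d e.1 e.2 != 0) tau de0) => e de tau_min.
have targetE : Z e.1 e.2 + tau e * d e.1 e.2 = target e.
  by rewrite /tau divfK // addrC subrK.
exists (tau e); first exact: tau_gt0.
split.
  move=> i j; rewrite !mxE; have [d_ge0|d_lt0] := leP 0 (d i j).
    by rewrite addr_ge0 // mulr_ge0 // ltW // tau_gt0.
  have dij : d (i, j).1 (i, j).2 != 0 by rewrite lt_eqF.
  apply: (@le_trans _ _ (target (i, j))).
    by rewrite /target /= ltNge (ltW d_lt0) /= ler0z floor_ge0.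
  have -> : target (i, j) = Z i j + tau (i, j) * d i j.
    by rewrite /tau divfK // addrC subrK.
  by rewrite lerD2l ler_nM2r // tau_min.
apply: proper_card; apply/properP; split.
  apply/fintype.subsetP => e'; rewrite !inE; apply: contra => Zint.
  by rewrite !mxE dF ?mulr0 ?addr0 // inE negbK.
exists e; first by rewrite inE fracP.
by rewrite inE negbK !mxE targetE /target; case: ifP => _; exact: intr_int.
Qed.

Lemma integral_sum_partner (R : realType) (n : nat) (f : 'I_n -> R) (i : 'I_n) :
  \sum_j f j \is a Num.int -> f i \isn't a Num.int ->
  exists2 j, j != i & f j \isn't a Num.int.
Proof.
move=> sum_int fi; apply: contrapT => all_int; case/negP: fi.
rewrite (_ : f i = \sum_j f j - \sum_(j | j != i) f j); last first.
  by rewrite (bigD1 i) //= addrK.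
rewrite rpredB // rpred_sum // => j ji.
by apply/negPn/negP => fj; apply: all_int; exists j.
Qed.

(** A form of Birkhoff's theorem for transportation polytopes that avoids
writing down convex combinations of vertices.  Fractional entries come in
pairs on every line, since the line sums are integers; so a circulation [d] on
them exists, and the matrix lies between two matrices [Z + t *: d] and
[Z - s *: d] with fewer fractional entries. *)
Lemma convex_integral_principle (R : realType) (p q : nat)
    (P : 'M[R]_(p, q) -> Prop) :
  (forall A B t, 0 <= t <= 1 -> P A -> P B -> P (t *: A + (1 - t) *: B)) ->
  forall r c,
  (forall Z : 'M[R]_(p, q), (forall i j, 0 <= Z i j) ->
     (forall i, \sum_j Z i j = r i) -> (forall j, \sum_i Z i j = c j) ->
     (forall i j, Z i j \is a Num.int) -> P Z) ->
  (forall i, r i \is a Num.int) -> (forall j, c j \is a Num.int) ->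
  forall Z : 'M[R]_(p, q), (forall i j, 0 <= Z i j) ->
     (forall i, \sum_j Z i j = r i) -> (forall j, \sum_i Z i j = c j) -> P Z.
Proof.
move=> Pconv r c Pint r_int c_int Z.
have [n] := ubnP #|fractional Z|; elim: n Z => // n IHn Z leZn Z_ge0 Zr Zc.
have [F0|F_neq0] := eqVneq (fractional Z) finset.set0.
  apply: Pint => // i j; have := finset.in_set0 (i, j).
  by rewrite -F0 inE => /negbFE.
have [|| d [d_neq0 dF dr dc]] := @circulation_exists R _ _ _ F_neq0.
- move=> [i j]; rewrite inE /= => Zij.
  have [|k kj Zik] := integral_sum_partner _ Zij; first by rewrite Zr.
  by exists (i, k); rewrite ?inE // xpair_eqE (negPf kj) andbF.
- move=> [i j]; rewrite inE /= => Zij.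
  have [|k ki Zkj] := @integral_sum_partner _ _ (Z^~ j) _ _ Zij.
    by rewrite Zc.
  by exists (k, j); rewrite ?inE // xpair_eqE (negPf ki).
have step (d' : 'M[R]_(p, q)) t : (forall i, \sum_j d' i j = 0) ->
    (forall j, \sum_i d' i j = 0) ->
    (forall i j, 0 <= (Z + t *: d') i j) ->
    (#|fractional (Z + t *: d')%R| < #|fractional Z|)%N -> P (Z + t *: d').
  move=> d'r d'c Z'_ge0 ltZ'; apply: IHn => //; first exact: leq_trans ltZ' _.
    move=> i; under eq_bigr do rewrite !mxE.
    by rewrite big_split /= -mulr_sumr d'r mulr0 addr0.
  move=> j; under eq_bigr do rewrite !mxE.
  by rewrite big_split /= -mulr_sumr d'c mulr0 addr0.
have [t t_gt0 [tZ tF]] := push_to_integer d_neq0 Z_ge0 dF.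
have [|i j ijF|s s_gt0 [sZ sF]] := @push_to_integer _ _ _ Z (- d) _ Z_ge0.
- by rewrite oppr_eq0.
- by rewrite mxE dF ?oppr0.
have ts : t + s != 0 by rewrite gt_eqF // addr_gt0.
have -> : Z = (s / (t + s)) *: (Z + t *: d) + (1 - s / (t + s)) *: (Z + s *: - d).
  by apply/matrixP => i j; rewrite !mxE; field.
apply: Pconv; last 2 first.
- exact: step.
- apply: step => //.
    by move=> i; under eq_bigr do rewrite mxE; rewrite sumrN dr oppr0.
  by move=> j; under eq_bigr do rewrite mxE; rewrite sumrN dc oppr0.
by rewrite ler_pdivrMr ?addr_gt0 // mul1r lerDr !ltW ?divr_gt0 ?addr_gt0.
Qed.

(** * Splitting a finite block *)

Definition line_entry (R : realType) (w : inf_matrix R) (g : line) (k : nat) :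
    R :=
  match g with inl i => w i k | inr j => w k j end.

Definition line_index (g : line) : nat :=
  match g with inl i => i | inr j => j end.

Definition partial_sum (R : realType) (w : inf_matrix R) (g : line) (n : nat) :
    R :=
  \sum_(k < n) line_entry w g k.

Definition substochastic (R : realType) (w : inf_matrix R) : Prop :=
  (forall i j, 0 <= w i j) /\ (forall g n, partial_sum w g n <= 1).

(** The upper left block of size [n] of [w], completed by a last row and a last
column (of index [n]) holding the defects of its line sums from 1.  The corner
is chosen so that the two border lines have sum [n]. *)
Definition bordered (R : realType) (w : inf_matrix R) (n : nat) :
    'M[R]_(n.+1) :=
  \matrix_(k, l)
    (if (k < n)%N then
       if (l < n)%N then w k l else 1 - partial_sum w (inl (k : nat)) n
     else if (l < n)%N then 1 - partial_sum w (inr (l : nat)) n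
     else \sum_(k' < n) \sum_(l' < n) w k' l').

Definition margin (R : realType) (n : nat) (k : 'I_n.+1) : R :=
  if (k < n)%N then 1 else n%:R.

Lemma bordered_ge0 (R : realType) (w : inf_matrix R) n k l :
  substochastic w -> 0 <= bordered w n k l.
Proof.
move=> [w_ge0 w_le1]; rewrite mxE.
do 2 case: ifP => _ //; rewrite ?subr_ge0 //.
by apply: sumr_ge0 => ? _; apply: sumr_ge0.
Qed.

Lemma bordered_row (R : realType) (w : inf_matrix R) n k :
  \sum_l bordered w n k l = margin R k.
Proof.
rewrite big_ord_recr /= /margin mxE ltnn; case: ifP => kn.
  rewrite (eq_bigr (fun l : 'I_n => w k l)) => [|l _].
    by rewrite /partial_sum /= addrC subrK.
  by rewrite mxE /= kn ltn_ord.
rewrite (eq_bigr (fun l : 'I_n => 1 - \sum_(k' < n) w k' l)) => [|l _]; last first.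
  by rewrite mxE /= kn ltn_ord.
by rewrite sumrB exchange_big subrK sumr_const card_ord.
Qed.

Lemma bordered_tr (R : realType) (w : inf_matrix R) n :
  (bordered w n)^T = bordered (fun i j => w j i) n.
Proof.
apply/matrixP => k l; rewrite !mxE /partial_sum /=.
by do 2 case: ifP => _ //; rewrite exchange_big.
Qed.

Lemma bordered_col (R : realType) (w : inf_matrix R) n l :
  \sum_k bordered w n k l = margin R l.
Proof.
rewrite -(bordered_row (fun i j => w j i) l) -bordered_tr.
by apply: eq_bigr => k _; rewrite !mxE.
Qed.

Lemma int_unit_interval (R : realType) (a : R) :
  a \is a Num.int -> 0 <= a <= 1 -> a = 0 \/ a = 1.
Proof.
move=> /intrP[m ->]; rewrite ler0z lerz1 => /andP[m_ge0 m_le1].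
have [->|->] : m = 0 \/ m = 1 by lia.
  by left.
by right.
Qed.

(** The matrix [B] is [Z i j] times the conditional expectation of a random
matching with expectation [Z], given that [i] is matched with [j].  Stated
with [B] rather than with the quotient, the property is convex in [Z]; and
for integral [Z], where [Z i j] is 0 or 1, one takes [B = 0] or [B = Z]. *)
Lemma bordered_split (R : realType) (n : nat) (i j : 'I_n.+1)
    (Z : 'M[R]_(n.+1)) :
  (i < n)%N -> (forall k l, 0 <= Z k l) ->
  (forall k, \sum_l Z k l = margin R k) ->
  (forall l, \sum_k Z k l = margin R l) ->
  exists B : 'M[R]_(n.+1),
    [/\ forall k l, 0 <= B k l <= Z k l, B i j = Z i j,
        forall k, \sum_l B k l = Z i j * margin R k &
        forall l, \sum_k B k l = Z i j * margin R l].
Proof.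
move=> i_n.
have margin_int k : margin R k \is a Num.int.
  by rewrite /margin; case: ifP => // _; exact: rpred_nat.
pose splits (A : 'M[R]_(n.+1)) := exists B : 'M[R]_(n.+1),
    [/\ forall k l, 0 <= B k l <= A k l, B i j = A i j,
        forall k, \sum_l B k l = A i j * margin R k &
        forall l, \sum_k B k l = A i j * margin R l].
apply: (@convex_integral_principle R _ _ splits _
  (@margin R n) (@margin R n)) => //.
- move=> A1 A2 t /andP[t_ge0 t_le1].
  move=> [B1 [B1A B1ij B1r B1c]] [B2 [B2A B2ij B2r B2c]].
  have s_ge0 : 0 <= 1 - t by rewrite subr_ge0.
  exists (t *: B1 + (1 - t) *: B2); split.
  + move=> k l; rewrite !mxE; have /andP[B1_ge0 B1le] := B1A k l.
    have /andP[B2_ge0 B2le] := B2A k l.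
    by apply/andP; split; [rewrite addr_ge0 ?mulr_ge0|rewrite lerD ?ler_wpM2l].
  + by rewrite !mxE B1ij B2ij.
  + move=> k; under eq_bigr do rewrite !mxE.
    rewrite big_split /= -!mulr_sumr B1r B2r !mxE; ring.
  + move=> k; under eq_bigr do rewrite !mxE.
    rewrite big_split /= -!mulr_sumr B1c B2c !mxE; ring.
move=> {}Z Z_ge0 Zr Zc Zint.
have Zij_le1 : Z i j <= 1.
  have := Zr i; rewrite /margin i_n => <-.
  by rewrite (bigD1 j) //= lerDl sumr_ge0.
have [|Z0|Z1] := int_unit_interval (Zint i j).
- by rewrite Z_ge0.
- exists 0; split=> [k l||k|k]; rewrite ?mxE ?lexx ?Z_ge0 ?Z0 ?mul0r //.
    by rewrite big1 // => l _; rewrite mxE.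
  by rewrite big1 // => l _; rewrite mxE.
- by exists Z; split=> [k l||k|k]; rewrite ?lexx ?Z_ge0 ?Z1 ?mul1r.
Qed.

(** The bounds are stated for all partial sums within the block, which is what
survives when [n] grows. *)
Lemma finite_split (R : realType) (w : inf_matrix R) (n i j : nat) :
  substochastic w -> (i < n)%N -> (j < n)%N ->
  exists B : inf_matrix R,
    [/\ forall k l, (k < n)%N -> (l < n)%N -> 0 <= B k l <= w k l,
        B i j = w i j &
        forall g m, (line_index g < n)%N -> (m <= n)%N ->
          partial_sum B g m <= w i j /\
          partial_sum (fun k l => w k l - B k l) g m <= 1 - w i j].
Proof.
move=> w_sub i_n j_n; pose Z := bordered w n.
pose i' : 'I_n.+1 := inord i; pose j' : 'I_n.+1 := inord j.
have i'E : i' = i :> nat by rewrite inordK // ltnS ltnW.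
have j'E : j' = j :> nat by rewrite inordK // ltnS ltnW.
have ZE k l : (k < n)%N -> (l < n)%N -> Z (inord k) (inord l) = w k l.
  by move=> kn ln; rewrite mxE !inordK ?kn ?ln // ltnS ltnW.
have [|k l|k|l|B [BZ Bij Br Bc]] := @bordered_split R n i' j' Z.
- by rewrite i'E.
- exact: bordered_ge0.
- exact: bordered_row.
- exact: bordered_col.
rewrite ZE // in Bij Br Bc.
exists (fun k l => B (inord k) (inord l)); split.
- by move=> k l kn ln; rewrite -(ZE k l).
- exact: Bij.
move=> g m gn mn.
(* Treating rows and columns at once: [f] and [h] list the entries, border
   included, of the two parts of the splitting along the line [g]. *)
have [f [h [[f_ge0 sumf fE] [h_ge0 sumh hE]]]] : exists f h : 'I_n.+1 -> R,
    [/\ forall k, 0 <= f k, \sum_k f k = w i j &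
        forall k : nat, (k < n)%N ->
          line_entry (fun k l => B (inord k) (inord l)) g k = f (inord k)] /\
    [/\ forall k, 0 <= h k, \sum_k h k = 1 - w i j &
        forall k : nat, (k < n)%N ->
          line_entry (fun k l => w k l - B (inord k) (inord l)) g k =
          h (inord k)].
  case: g gn => [k|l] /= gn.
  - have mk : margin R (inord k : 'I_n.+1) = 1.
      by rewrite /margin inordK ?gn // ltnS ltnW.
    exists (B (inord k)), (fun l => Z (inord k) l - B (inord k) l); split; split.
    + by move=> l; case/andP: (BZ (inord k) l).
    + by rewrite Br mk mulr1.
    + by [].
    + by move=> l; rewrite subr_ge0; case/andP: (BZ (inord k) l).
    + by rewrite sumrB Br bordered_row mk mulr1.
    + by move=> l ln; rewrite ZE.
  - have ml : margin R (inord l : 'I_n.+1) = 1.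
      by rewrite /margin inordK ?gn // ltnS ltnW.
    exists (B^~ (inord l)), (fun k => Z k (inord l) - B k (inord l)); split; split.
    + by move=> k; case/andP: (BZ k (inord l)).
    + by rewrite Bc ml mulr1.
    + by [].
    + by move=> k; rewrite subr_ge0; case/andP: (BZ k (inord l)).
    + by rewrite sumrB Bc bordered_col ml mulr1.
    + by move=> k kn; rewrite ZE.
have sum_le (u : inf_matrix R) (v : 'I_n.+1 -> R) : (forall k, 0 <= v k) ->
    (forall k : nat, (k < n)%N -> line_entry u g k = v (inord k)) ->
    partial_sum u g m <= \sum_k v k.
  move=> v_ge0 uE; rewrite /partial_sum.
  have mn1 : (m <= n.+1)%N by rewrite ltnW.
  rewrite [leRHS](eq_bigr (fun k : 'I_n.+1 => v (inord k))); last first.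
    by move=> k _; rewrite inord_val.
  rewrite (eq_bigr (fun k : 'I_m => v (inord k))) => [|k _]; last first.
    by rewrite uE // (leq_trans (ltn_ord k)).
  rewrite -(big_mkord xpredT (fun k => v (inord k))).
  rewrite -[leRHS](big_mkord xpredT (fun k => v (inord k))).
  by rewrite [leRHS](big_cat_nat (leq0n m) mn1) //= lerDl sumr_ge0.
by split; [rewrite -sumf; exact: sum_le|rewrite -sumh; exact: sum_le].
Qed.

(** * Splitting an infinite substochastic matrix *)

Lemma ultra_fmap (T U : Type) (f : T -> U) (F : set_system T) :
  UltraFilter F -> UltraFilter (f @ F).
Proof.
move=> FU; apply: Build_UltraFilter => G GP leG; apply/seteqP; split=> // A GA.
have [//|FA] := @in_ultra_setVsetC _ _ (f @^-1` A) FU.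
have GcA : G (~` A) by apply: leG.
by have /filter_ex[x []] : G (A `&` ~` A) by exact: filterI.
Qed.

Lemma ultra_bounded_cvg (R : realType) (U : set_system nat) (u : nat -> R)
    (a b : R) :
  UltraFilter U -> (\forall n \near U, a <= u n <= b) ->
  exists2 l : R, a <= l <= b & u n @[n --> U] --> l.
Proof.
move=> UU uab; have UuU := @ultra_fmap _ _ u U UU.
have := @segment_compact R a b; rewrite compact_ultra.
move=> /(_ _ UuU)[|l [lab ul]].
  by apply: filterS uab => n; rewrite /= in_itv.
by exists l => //; move: lab; rewrite /= in_itv.
Qed.

(** Compactness: the splittings of the growing blocks lie entrywise between 0 and
[w], so they converge along an ultrafilter, and bounds on finite partial sums
pass to the limit.  Bounding [w - B] as well as [B] prevents mass from being
lost at infinity: it forces [B] to have sum [w i j] on each line where [w] has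
sum 1. *)
Lemma substochastic_split (R : realType) (w : inf_matrix R) (i j : nat) :
  substochastic w ->
  exists B : inf_matrix R,
    [/\ forall k l, 0 <= B k l <= w k l, B i j = w i j &
        forall g m, partial_sum B g m <= w i j /\
          partial_sum (fun k l => w k l - B k l) g m <= 1 - w i j].
Proof.
move=> w_sub.
have ex n : exists B : inf_matrix R,
    [/\ forall k l, (k < n)%N -> (l < n)%N -> 0 <= B k l <= w k l,
        (i < n)%N -> (j < n)%N -> B i j = w i j &
        forall g m, (i < n)%N -> (j < n)%N -> (line_index g < n)%N ->
          (m <= n)%N ->
          partial_sum B g m <= w i j /\
          partial_sum (fun k l => w k l - B k l) g m <= 1 - w i j].
  have [in_|ni] := ltnP i n; last first.
    by exists w; split=> // k l _ _; rewrite lexx andbT; case: w_sub.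
  have [jn|nj] := ltnP j n; last first.
    by exists w; split=> // k l _ _; rewrite lexx andbT; case: w_sub.
  by have [B [? ? ?]] := finite_split w_sub in_ jn; exists B; split=> // *; auto.
pose b n := sval (cid (ex n)).
have bP n := svalP (cid (ex n)).
have [U [UU leU]] := ultraFilterLemma (@eventually_filter).
have big N : \forall n \near U, (N < n)%N by apply: leU; exact: nbhs_infty_gt.
pose is_lim (e : nat * nat) (l : R) :=
  0 <= l <= w e.1 e.2 /\ b n e.1 e.2 @[n --> U] --> l.
have [B /all_and2[BP bB]] : {B : nat * nat -> R & forall e, is_lim e (B e)}.
  apply: (@choice _ _ is_lim).
  move=> [k l] /=.
  have [|L ? ?] := @ultra_bounded_cvg R U (fun n => b n k l) 0 (w k l) UU.
    apply: filterS2 (big k) (big l) => n kn ln; have [h _ _] := bP n; exact: h.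
  by exists L.
have ps_cvg g m : partial_sum (b n) g m @[n --> U] -->
    partial_sum (fun k l => B (k, l)) g m.
  rewrite /partial_sum; apply: cvg_big => [|k _]; first exact: add_continuous.
  by case: g => k' /=; exact: (bB (_, _)).
have le_lim (u : nat -> R) a l : u n @[n --> U] --> l ->
    (\forall n \near U, u n <= a) -> l <= a.
  by move=> ul ua; exact: (closed_cvg (fun x => x <= a) (@closed_le R a) ua l ul).
have ps_sub C g m : partial_sum (fun k l => w k l - C k l) g m =
    partial_sum w g m - partial_sum C g m.
  by rewrite /partial_sum -sumrB; apply: eq_bigr => k _; case: g.
exists (fun k l => B (k, l)); split.
- by move=> k l; exact: (BP (k, l)).
- have bij : b n i j @[n --> U] --> w i j.
    apply: cvg_near_cst; apply: filterS2 (big i) (big j) => n in_ jn.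
    by have [_ h _] := bP n; exact: h.
  exact: (cvg_unique _ (bB (i, j)) bij).
move=> g m.
have near4 : \forall n \near U,
    [/\ (i < n)%N, (j < n)%N, (line_index g < n)%N & (m <= n)%N].
  near=> n; split; last apply: ltnW; near: n; exact: big.
split.
  apply: le_lim (ps_cvg g m) _; apply: filterS near4 => n [? ? ? ?].
  by have [_ _ /(_ g m)[]] := bP n.
rewrite ps_sub lerBlDr -lerBlDl.
have lim2 : partial_sum w g m - (1 - w i j) - partial_sum (b n) g m
    @[n --> U] --> partial_sum w g m - (1 - w i j) -
    partial_sum (fun k l => B (k, l)) g m.
  by apply: cvgB => //; exact: cvg_cst.
rewrite -subr_le0; apply: le_lim lim2 _; apply: filterS near4 => n [? ? ? ?].
have [_ _ /(_ g m)[]//] := bP n.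
by rewrite ps_sub => _; lra.
Unshelve. all: by end_near. Qed.

(** * Splitting inside the class of matrices *)

Lemma line_sumE (R : realType) (w : inf_matrix R) (g : line) :
  line_sum w g = (\sum_(0 <= k <oo) (line_entry w g k)%:E)%E.
Proof. by case: g. Qed.

Lemma line_entry_ge0 (R : realType) (w : inf_matrix R) (g : line) k :
  (forall i j, 0 <= w i j) -> 0 <= line_entry w g k.
Proof. by case: g => ? w_ge0 /=. Qed.

Lemma line_sum_ge0 (R : realType) (w : inf_matrix R) (g : line) :
  (forall i j, 0 <= w i j) -> (0 <= line_sum w g)%E.
Proof.
move=> w_ge0; rewrite line_sumE; apply: nneseries_ge0 => k _ _.
by rewrite lee_fin line_entry_ge0.
Qed.

Lemma Smat_substochastic (R : realType) (G1 : set line) (w : inf_matrix R) :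
  Smat G1 w -> substochastic w.
Proof.
move=> [w_ge0 w_le1 _]; split=> // g n; rewrite -lee_fin.
apply: le_trans (w_le1 g); rewrite line_sumE /partial_sum -sumEFin.
rewrite -(big_mkord xpredT (fun k => (line_entry w g k)%:E)).
by apply: nneseries_lim_ge => k _ _; rewrite lee_fin line_entry_ge0.
Qed.

Lemma substochastic_line_sum (R : realType) (w : inf_matrix R) g :
  substochastic w -> (line_sum w g <= 1)%E.
Proof.
move=> [w_ge0 w_le1]; rewrite line_sumE; apply: lime_le.
  by apply: is_cvg_nneseries => k _ _; rewrite lee_fin line_entry_ge0.
apply: nearW => n; rewrite big_mkord sumEFin lee_fin; exact: w_le1.
Qed.

Lemma line_entry_le1 (R : realType) (w : inf_matrix R) g k :
  substochastic w -> line_entry w g k <= 1.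
Proof.
move=> [w_ge0 w_le1]; apply: le_trans (w_le1 g k.+1).
rewrite /partial_sum big_ord_recr /= lerDr sumr_ge0 // => l _.
exact: line_entry_ge0.
Qed.

Lemma line_entry_one (R : realType) (w : inf_matrix R) g k l :
  substochastic w -> line_entry w g k = 1 -> l != k -> line_entry w g l = 0.
Proof.
move=> [w_ge0 w_le1] wk lk; apply/eqP; rewrite eq_le line_entry_ge0 // andbT.
have kn : (k < (k + l).+1)%N by rewrite ltnS leq_addr.
have ln : (l < (k + l).+1)%N by rewrite ltnS leq_addl.
have := w_le1 g (k + l).+1; rewrite /partial_sum (bigD1 (Ordinal kn)) //=.
rewrite (bigD1 (Ordinal ln)) ?lk //= wk.
rewrite gerDl; apply: le_trans; rewrite lerDl.
by apply: sumr_ge0 => ? _; rewrite line_entry_ge0.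
Qed.

(** The class is a face among substochastic matrices: where a proper mean of two
numbers at most 1 is 1, both are 1; and [t * w1 <= w] entrywise, so absolute
convergence of the series of [w] is inherited by [w1]. *)
Lemma face_member (R : realType) (G1 : set line) (x : R^nat)
    (w w1 w2 : inf_matrix R) (t : R) :
  0 < t < 1 -> substochastic w1 -> substochastic w2 ->
  (forall k l, w k l = t * w1 k l + (1 - t) * w2 k l) ->
  (Smat G1 `&` Vmat x) w -> (Smat G1 `&` Vmat x) w1.
Proof.
move=> /andP[t_gt0 t_lt1] w1_sub w2_sub wE [[_ _ w_eq1] wV].
have s_gt0 : 0 < 1 - t by rewrite subr_gt0.
have [w1_ge0 _] := w1_sub; have [w2_ge0 _] := w2_sub.
split; [split=> // g|].
- exact: substochastic_line_sum.
- move=> /w_eq1.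
  have -> : line_sum w g = (t%:E * line_sum w1 g + (1 - t)%:E * line_sum w2 g)%E.
    rewrite !line_sumE -!nneseriesZl => [|k _|k _];
      try by rewrite lee_fin line_entry_ge0.
    rewrite -nneseriesD => [|k _ _|k _ _]; last 2 first.
    - by rewrite lee_fin mulr_ge0 ?line_entry_ge0 // ltW.
    - by rewrite lee_fin mulr_ge0 ?line_entry_ge0 // ltW.
    apply: eq_eseriesr => k _; rewrite -!EFinM -EFinD.
    by case: g => g /=; rewrite wE.
  have := substochastic_line_sum g w1_sub; have := line_sum_ge0 g w1_ge0.
  have := substochastic_line_sum g w2_sub; have := line_sum_ge0 g w2_ge0.
  case: (line_sum w1 g) (line_sum w2 g) => [r1||] [r2||] //=.
  rewrite !lee_fin -!EFinM -EFinD => r2_ge0 r2_le1 r1_ge0 r1_le1 [] sum1.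
  by congr EFin; nra.
- move=> i; apply: (@le_lt_trans _ _
    (t^-1%:E * \sum_(0 <= j <oo) `|w i j * x j|%:E)%E).
    rewrite -nneseriesZl => [|j _]; last by rewrite lee_fin.
    apply: lee_nneseries => [j _ _|j _]; rewrite -?EFinM lee_fin //.
    rewrite !normrM mulrA ler_wpM2r // !ger0_norm //; last first.
      by rewrite wE addr_ge0 // mulr_ge0 // ltW.
    rewrite wE mulrDr mulKf ?gt_eqF // lerDl.
    by rewrite mulr_ge0 ?invr_ge0 ?mulr_ge0 // ltW.
  by apply: lte_mul_pinfty => //; rewrite lee_fin invr_ge0 ltW.
Qed.

Lemma Smat_split (R : realType) (G1 : set line) (x : R^nat)
    (w : inf_matrix R) (i j : nat) :
  (Smat G1 `&` Vmat x) w -> 0 < w i j < 1 ->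
  exists w1 w2 : inf_matrix R,
    [/\ (Smat G1 `&` Vmat x) w1, (Smat G1 `&` Vmat x) w2, w1 i j = 1 &
        forall k l, w k l = w i j * w1 k l + (1 - w i j) * w2 k l].
Proof.
move=> wSV a01; have /andP[a_gt0 a_lt1] := a01.
have w_sub := Smat_substochastic wSV.1.
have [B [BP Bij Bsum]] := substochastic_split i j w_sub.
set a := w i j in a01 a_gt0 a_lt1 Bij Bsum *.
have s_gt0 : 0 < 1 - a by rewrite subr_gt0.
have scale_sub c (C : inf_matrix R) : 0 < c -> (forall k l, 0 <= C k l) ->
    (forall g m, partial_sum C g m <= c) -> substochastic (fun k l => C k l / c).
  move=> c_gt0 C_ge0 C_le; split=> [k l|g m]; first by rewrite divr_ge0 // ltW.
  have -> : partial_sum (fun k l => C k l / c) g m = partial_sum C g m / c.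
    by rewrite /partial_sum mulr_suml; apply: eq_bigr => k _; case: g.
  by rewrite ler_pdivrMr // mul1r.
have w1_sub := scale_sub a B a_gt0
  (fun k l => (andP (BP k l)).1) (fun g m => (Bsum g m).1).
have BP' k l : 0 <= w k l - B k l by rewrite subr_ge0; case/andP: (BP k l).
have w2_sub := scale_sub (1 - a) _ s_gt0 BP' (fun g m => (Bsum g m).2).
have wE k l : w k l = a * (B k l / a) + (1 - a) * ((w k l - B k l) / (1 - a)).
  by field; rewrite !gt_eqF.
exists (fun k l => B k l / a), (fun k l => (w k l - B k l) / (1 - a)).
split=> //.
- exact: (face_member a01 w1_sub w2_sub wE).
- apply: (@face_member _ _ _ w _ (fun k l => B k l / a) (1 - a)) => //.
    by rewrite s_gt0 gtrBl.
  by move=> k l; rewrite subKr addrC; exact: wE.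
- by rewrite Bij divff // gt_eqF.
Qed.

Lemma mx_act_convex (R : realType) (x : R^nat) (w w1 w2 : inf_matrix R) (t : R) :
  Vmat x w1 -> Vmat x w2 ->
  (forall k l, w k l = t * w1 k l + (1 - t) * w2 k l) ->
  mx_act w x = t *: (mx_act w1 x : R^nat) + (1 - t) *: (mx_act w2 x : R^nat).
Proof.
move=> w1V w2V wE; apply/funext => i.
have cvg_row (v : inf_matrix R) : Vmat x v -> cvgn (series (fun j => v i j * x j)).
  move=> vV; apply: normed_cvg.
  by apply: (@nnseries_is_cvg _ (fun j => `|v i j * x j|)) => //; exact: (vV i).
rewrite /mx_act [RHS]/=.
rewrite -[X in _ = X]/(t *: limn (series (fun j => w1 i j * x j)) +
  (1 - t) *: limn (series (fun j => w2 i j * x j))).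
rewrite -!lim_seriesZ; try exact: cvg_row.
rewrite -lim_seriesD; try by apply: is_cvg_seriesZ; exact: cvg_row.
congr (limn (series _)); apply/funext => j.
by rewrite wE mulrDl -!mulrA.
Qed.

Lemma mx_act_single_entry (R : realType) (x : R^nat) (w : inf_matrix R)
    (i j : nat) :
  (forall k, k != j -> w i k = 0) -> mx_act w x i = w i j * x j.
Proof.
move=> w0; apply: cvg_lim => //; apply: cvg_near_cst.
near=> n; rewrite /series /= (big_rem j) /=; last first.
  by rewrite mem_index_iota /=; near: n; exact: nbhs_infty_gt.
rewrite big1_seq ?addr0 // => k /andP[_].
by rewrite mem_rem_uniq ?iota_uniq // => /andP[kj _]; rewrite w0 ?mul0r.
Unshelve. all: by end_near. Qed.

(** * Extreme points of the orbit *)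

Lemma trunc_convex (R : realType) (m : option nat) (u v : R^nat) (t : R) :
  trunc m (t *: u + (1 - t) *: v) =
  t *: (trunc m u : R^nat) + (1 - t) *: (trunc m v : R^nat).
Proof.
case: m => [n|] //=; apply/funext => i /=.
rewrite -[RHS]/(t * (if (i < n)%N then u i else 0) +
  (1 - t) * (if (i < n)%N then v i else 0)).
by case: ifP => // _; rewrite !mulr0 addr0.
Qed.

Definition represents (R : realType) (m : option nat) (G1 : set line)
    (x y : R^nat) (w : inf_matrix R) : Prop :=
  (Smat G1 `&` Vmat x) w /\ trunc m (mx_act w x) = y.

Definition settles (R : realType) (w w' : inf_matrix R) : Prop :=
  forall k l, w k l = 0 \/ w k l = 1 -> w' k l = w k l.

(** The image of [w] is the mean, with weights [w i j] and [1 - w i j], of the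
images of the two parts of its splitting at [(i, j)]; by extremality the first
part has the image [y] too.  An entry 0 or 1 of [w] is an extreme value among
entries of substochastic matrices, so both parts agree with [w] there. *)
Lemma extreme_force_entry (R : realType) (m : option nat) (G1 : set line)
    (x y : R^nat) (w : inf_matrix R) (i j : nat) :
  extreme_points (Sset_trunc m G1 x) y -> represents m G1 x y w ->
  0 < w i j ->
  exists w', [/\ represents m G1 x y w', settles w w' & w' i j = 1].
Proof.
move=> [_ y_ext] [wSV wy] a_gt0.
have := line_entry_le1 (inl i) j (Smat_substochastic wSV.1).
rewrite /= le_eqVlt => /predU1P[a1|a_lt1]; first by exists w.
have a01 : 0 < w i j < 1 by rewrite a_gt0.
have [w1 [w2 [w1SV w2SV w1ij wE]]] := Smat_split wSV a01.
have y_conv : y = w i j *: (trunc m (mx_act w1 x) : R^nat) +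
    (1 - w i j) *: (trunc m (mx_act w2 x) : R^nat).
  by rewrite -trunc_convex -wy (mx_act_convex w1SV.2 w2SV.2 wE).
have memS v : (Smat G1 `&` Vmat x) v -> Sset_trunc m G1 x (trunc m (mx_act v x)).
  by move=> vSV; exists (mx_act v x) => //; exists v.
have w1y : trunc m (mx_act w1 x) = y.
  apply: contrapT => w1y; apply: y_ext.
  exists (trunc m (mx_act w1 x)), (trunc m (mx_act w2 x)), (w i j); split=> //.
  - by split; exact: memS.
  - (* if the second part has image [y], then so does the first *)
    split=> // w2y; apply: w1y.
    apply/funext => k; apply: (mulfI (lt0r_neq0 a_gt0)).
    have : y k = w i j * trunc m (mx_act w1 x) k + (1 - w i j) * y k.
      by rewrite {1}y_conv w2y.
    by move=> yk; lra.
  - by rewrite !ltW.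
exists w1; split=> // k l.
have [w1_ge0 _] := Smat_substochastic w1SV.1.
have [w2_ge0 _] := Smat_substochastic w2SV.1.
have := line_entry_le1 (inl k) l (Smat_substochastic w1SV.1).
have := line_entry_le1 (inl k) l (Smat_substochastic w2SV.1).
have := w1_ge0 k l; have := w2_ge0 k l; have := wE k l => /= {wE}.
by move=> wE b_ge0 a_ge0 b_le1 a_le1 [] wkl; rewrite wkl in wE *; nra.
Qed.

Lemma extreme_settle_line (R : realType) (m : option nat) (G1 : set line)
    (x y : R^nat) (w : inf_matrix R) (g : line) :
  extreme_points (Sset_trunc m G1 x) y -> represents m G1 x y w ->
  exists w', [/\ represents m G1 x y w', settles w w' &
    forall k, line_entry w' g k = 0 \/ line_entry w' g k = 1].
Proof.
move=> y_ext wy; have w_ge0 := (Smat_substochastic wy.1.1).1.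
have [[k wk]|w0] := pselect (exists k, line_entry w g k != 0); last first.
  exists w; split=> // k; left; apply/eqP/negP => /negP wk; apply: w0.
  by exists k.
have [w' [w'y ww' w'k]] : exists w', [/\ represents m G1 x y w', settles w w' &
    line_entry w' g k = 1].
  have wk_gt0 : 0 < line_entry w g k by rewrite lt0r wk line_entry_ge0.
  by case: g wk wk_gt0 => /= i _ ?; exact: extreme_force_entry.
exists w'; split=> // l.
have [->|lk] := eqVneq l k; first by right.
by left; apply: line_entry_one w'k lk; exact: Smat_substochastic w'y.1.1.
Qed.

(** The matrix [W n] is obtained from a matrix with image [y] by settling the
first [n] lines of an enumeration, and [T g] is the stage at which the line
[g] is settled; its entries do not change any more.  Each line of the limit
[p] is thus a line of one of the [W n].  This is what preserves line sums and
the coordinates of [p x], although neither depends continuously on the entries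
of a matrix. *)
Lemma extreme_in_Pset (R : realType) (m : option nat) (G1 : set line)
    (x y : R^nat) :
  extreme_points (Sset_trunc m G1 x) y -> Pset_trunc m G1 x y.
Proof.
move=> y_ext; have [_ [w0 w0SV <-] w0y] := y_ext.1.
pose is_next (wg : inf_matrix R * line) (w' : inf_matrix R) :=
  represents m G1 x y wg.1 ->
  [/\ represents m G1 x y w', settles wg.1 w' &
      forall k, line_entry w' wg.2 k = 0 \/ line_entry w' wg.2 k = 1].
have [next nextP] : {next : inf_matrix R * line -> inf_matrix R &
    forall wg, is_next wg (next wg)}.
  apply: (@choice _ _ is_next).
  move=> [w g]; have [wy|] := pselect (represents m G1 x y w); last by exists w.
  by have [w' ?] := extreme_settle_line g y_ext wy; exists w'.
pose step n w := if unpickle n is Some g then next (w, g : line) else w.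
pose W := fix W n := if n is n'.+1 then step n' (W n') else w0.
have WS n : W n.+1 = step n (W n) by [].
have Wy n : represents m G1 x y (W n).
  elim: n => [|n IHn]; first by split.
  rewrite WS /step; case: unpickle => [g|] //.
  by have [] := nextP (W n, g : line) IHn.
have Wsettle n d : settles (W n) (W (n + d)%N).
  elim: d => [|d IHd] k l wkl; first by rewrite addn0.
  rewrite addnS WS /step; have {}IHd := IHd k l wkl.
  case: unpickle => [g|] //.
  have [_ h _] := nextP (W (n + d)%N, g : line) (Wy _).
  by rewrite h /= IHd.
pose T (g : line) := (pickle (g : nat + nat)%type).+1.
have WT g k : line_entry (W (T g)) g k = 0 \/ line_entry (W (T g)) g k = 1.
  by rewrite /T WS /step pickleK; have [] := nextP (W (pickle g), g) (Wy _).
pose p : inf_matrix R := fun k l => W (T (inl k)) k l.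
have pE g k : line_entry p g k = line_entry (W (T g)) g k.
  case: g => // j; rewrite /= /p.
  have := Wsettle (T (inl k)) (T (inr j)) k j (WT (inl k) j).
  by rewrite addnC (Wsettle _ _ _ _ (WT (inr j) k)).
have p_line_sum g : line_sum p g = line_sum (W (T g)) g.
  by rewrite !line_sumE; apply: eq_eseriesr => k _; rewrite pE.
have pS : Smat G1 p.
  split=> [i j|g|g G1g].
  - exact: (Smat_substochastic (Wy (T (inl i))).1.1).1.
  - by rewrite p_line_sum; have [[[_ h _] _] _] := Wy (T g).
  - by rewrite p_line_sum; have [[[_ _ h] _] _] := Wy (T g); exact: h.
exists (mx_act p x).
  by exists p => //; split=> // i j; exact: (WT (inl i) j).
apply/funext => i; have [_ <-] := Wy (T (inl i)).
by rewrite /trunc; case: (m).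
Qed.

(** Splitting [w] at [(i, j)] yields a matrix with the same image whose row [i] is
concentrated at column [j]. *)
Lemma extreme_value_on_support (R : realType) (G1 : set line) (x : R^nat)
    (w : inf_matrix R) (i j : nat) :
  extreme_points (Sset G1 x) (mx_act w x) -> (Smat G1 `&` Vmat x) w ->
  0 < w i j -> mx_act w x i = x j.
Proof.
move=> y_ext wSV wij.
have SE : Sset_trunc None G1 x = Sset G1 x.
  by apply/seteqP; split=> [_ [y yS <-]|y yS] //; exists y.
rewrite -SE in y_ext.
have [|w' [[w'SV <-] _ w'ij]] := extreme_force_entry y_ext _ wij; first by split.
rewrite /= (@mx_act_single_entry _ _ _ _ j) ?w'ij ?mul1r // => k.
exact: (@line_entry_one _ w' (inl i) j k (Smat_substochastic w'SV.1) w'ij).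
Qed.

Theorem theorem3p15 (R : realType) (x : R^nat) (G1 : set line)
    (m : option nat) (m_pos : m <> Some 0%N)
    (hyp : [\/ m <> None,
               m = None /\ (G1 `<=` all_rows \/ all_cols `<=` G1) |
               m = None /\ (forall j k : nat, j <> k -> x j <> x k)]) :
  extreme_points (Sset_trunc m G1 x) `<=` Pset_trunc m G1 x /\
  (m = None /\ (forall j k : nat, j <> k -> x j <> x k) ->
   (forall j : nat, x j <> 0) ->
   forall w : inf_matrix R,
     ((@Smat R G1 `\` @Pmat R G1) `&` Vmat x) w ->
     ~ extreme_points (Sset G1 x) (mx_act w x)).
Proof.
split=> [y|[_ x_inj] x_neq0 w [[wS wNP] wV] y_ext]; first exact: extreme_in_Pset.
apply: wNP; split=> // i j.
have [w_ge0 _] := Smat_substochastic wS.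
have [->|wij_neq0] := eqVneq (w i j) 0; [by left|right].
have wij_gt0 : 0 < w i j by rewrite lt0r wij_neq0 w_ge0.
have yi := extreme_value_on_support y_ext (conj wS wV) wij_gt0.
have w0 k : k != j -> w i k = 0.
  move=> kj; apply: contrapT => /eqP wik_neq0.
  have wik_gt0 : 0 < w i k by rewrite lt0r wik_neq0 w_ge0.
  have := extreme_value_on_support y_ext (conj wS wV) wik_gt0.
  by rewrite yi; apply: x_inj => jk; rewrite jk eqxx in kj.
have : w i j * x j = 1 * x j by rewrite mul1r -(mx_act_single_entry x w0).
by move/mulIf; apply; apply/eqP.
Qed.
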